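(* For each integer $l \geq 1$, the sequence $(a_j)_{j \geq 1}$ with $a_j = \nu_2(A_{l,\,l+j-1})$ (that is, the sequence $\nu_2(A_{l,m})$, $m \geq l$) is $s$-simple with $s = 2^{1+\nu_2(l)}$.
   Context: For integers $m \geq 1$ and $0 \leq l \leq m$, $A_{l,m} = \frac{l!\, m!}{2^{m-l}} \sum_{k=l}^{m} 2^{k} \binom{2m-2k}{m-k}\binom{m+k}{m}\binom{k}{l}$ (nonzero integers). $\nu_2$ denotes the $2$-adic valuation. For $s \geq 2$, a sequence $(a_j)_{j\geq 1}$ is $s$-simple if $s$ is the largest integer such that $a_{st+1} = a_{st+2} = \cdots = a_{s(t+1)}$ for every $t \geq 0$. *)

(* Defs.v *)
From HB Require Import structures.
From mathcomp Require Import all_boot all_order all_algebra.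

Set Implicit Arguments.
Unset Strict Implicit.
Unset Printing Implicit Defensive.

Import Order.TTheory GRing.Theory Num.Theory.
Local Open Scope ring_scope.

(* Rational-valued, so that dividing by 2 ^ (m - l) is exact; the values are in
   fact nonzero integers for 1 <= m and l <= m. *)
Definition A (l m : nat) : rat :=
  (l`! * m`!)%:R / 2%:R ^+ (m - l) *
  \sum_(l <= k < m.+1)
    (2 ^ k * 'C(2 * m - 2 * k, m - k) * 'C(m + k, m) * 'C(k, l))%:R.

(* The 2-adic valuation on rat; the (meaningless) value at 0 is 0. *)
Definition nu2 (x : rat) : int :=
  (logn 2 `|numq x|)%:Z - (logn 2 `|denq x|)%:Z.

(* Sequences are indexed from 1: the term a 0 is never used. *)
Definition block_constant (T : Type) (s : nat) (a : nat -> T) : Prop :=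
  forall t j : nat, (s * t + 1 <= j <= s * (t + 1))%N -> a j = a (s * t + 1)%N.

Definition simple_seq (T : Type) (s : nat) (a : nat -> T) : Prop :=
  [/\ (2 <= s)%N, block_constant s a &
      forall s' : nat, block_constant s' a -> (s' <= s)%N].

(* Main.v *)
(** For fixed [m] put [P(x) = \sum_k 2^k C(2m-2k, m-k) C(m+k, m) x^k]; then
    [A l m = m! P^(l)(1) / 2^(m-l)].  The ratio of consecutive coefficients of
    [P] gives a hypergeometric equation
      [(x^2 - 2x) P'' + (2m-1 + 2x) P' = m(m+1) P],
    whose [l]-th derivative at [x = 1] is a three-term recurrence in [l].
    Writing [A l m = 2^l (m+l)!/(m-l)! B l], it becomes
      [B l = (2m+1) B (l+1) - (m-l-1)(m+l+2) B (l+2)],  [B m = 1],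
    and as [(m-l-1)(m+l+2)] is even, every [B l] is odd.  Hence the sequence is
    [a_j = l + nu_2 (j (j+1) ... (j+2l-1))], and [a_(j+1) - a_j] equals
    [nu_2 (j+2l) - nu_2 j], which vanishes exactly when [2^(1 + nu_2 l)] does not
    divide [j]. *)
Require Import Defs.
From HB Require Import structures.
From mathcomp Require Import all_boot all_order all_algebra.
From mathcomp Require Import ring zify.

Set Implicit Arguments.
Unset Strict Implicit.
Unset Printing Implicit Defensive.

Import Order.TTheory GRing.Theory Num.Theory.
Local Open Scope ring_scope.

Definition Pcoef (m k : nat) : nat :=
  (2 ^ k * 'C(2 * m - 2 * k, m - k) * 'C(m + k, m))%N.

Definition P (m : nat) : {poly rat} := \poly_(k < m.+1) (Pcoef m k)%:R.

Lemma central_binS n :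
  (n.+1 * 'C(2 * n.+1, n.+1) = 2 * (2 * n + 1) * 'C(2 * n, n))%N.
Proof.
have h1 := mul_bin_diag (2 * n).+2 n.
have h2 := mul_bin_down (2 * n).+1 n.
rewrite (_ : (2 * n).+1 - n = n.+1)%N in h2; last by lia.
by rewrite (_ : 2 * n.+1 = (2 * n).+2)%N; [rewrite /= in h1 h2; lia|lia].
Qed.

Lemma PcoefS m k : (k < m)%N ->
  (k.+1 * (2 * m - 2 * k - 1) * Pcoef m k.+1 =
   (m - k) * (m + k + 1) * Pcoef m k)%N.
Proof.
move=> lt_km; pose n := (m - k - 1)%N.
have hc := central_binS n.
have hb : (k.+1 * 'C(m + k.+1, m) = (m + k + 1) * 'C(m + k, m))%N.
  have := mul_bin_down (m + k).+1 m; rewrite /= addnS.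
  by rewrite (_ : (m + k).+1 - m = k.+1)%N ?addn1; [move=> <-|lia].
rewrite /Pcoef.
have -> : (2 * m - 2 * k.+1 = 2 * n)%N by lia.
have -> : (m - k.+1 = n)%N by lia.
have -> : (2 * m - 2 * k - 1 = 2 * n + 1)%N by lia.
have -> : (2 * m - 2 * k = 2 * n.+1)%N by lia.
have -> : (m - k = n.+1)%N by lia.
rewrite expnS.
transitivity (2 ^ k * (2 * (2 * n + 1) * 'C(2 * n, n)) *
   (k.+1 * 'C(m + k.+1, m)))%N; first by ring.
by rewrite -hc hb; ring.
Qed.

Lemma P_ode m :
  ('X^2 - 2%:R *: 'X) * (P m)^`(2)
  + ((2%:R *: 'X) + (2%:R * m%:R - 1)%:P) * (P m)^`(1)
  - (m%:R * (m%:R + 1)) *: P m = 0.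
Proof.
apply/polyP => k.
rewrite coef0 mulrBl mulrDl -!scalerAl mul_polyC.
rewrite !(coefB, coefD, coefZ, coefXnM, coefXM, coef_derivn).
have key : (k.+1)%:R * (2 * m%:R - 2 * k%:R - 1) * (P m)`_k.+1 =
   (m%:R - k%:R) * (m%:R + k%:R + 1) * (P m)`_k :> rat.
  rewrite !coef_poly; case: (ltnP k m) => [lt_km|le_mk].
    rewrite !ltnS lt_km (ltnW lt_km).
    have /(congr1 (fun n => n%:R : rat)) := PcoefS lt_km.
    by rewrite !natrM !natrD !natrB ?natrM //; lia.
  (* Beyond the degree the coefficients are the default zero. At [k = m] the factor [m - k]
     vanishes, so the relation extends to every [k]. *)
  rewrite ltnS ltnNge le_mk mulr0; case: ltnP; last by rewrite mulr0.
  by move=> le_km; rewrite (_ : k = m) ?subrr ?mul0r //; lia.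
(* The coefficient of ['X^k] in the equation is the difference of the two sides of [key]. The cases
   [k = 0] and [k = 1] stand apart because multiplying by ['X] or ['X^2] shifts the index. *)
move/eqP: key; rewrite -subr_eq0 => /eqP key; rewrite -[RHS]key.
case: k {key} => [|[|k]]; rewrite /= ?(add1n, add2n, addn0, subSS, subn0).
- by rewrite !ffactn1 !mulr0; ring.
- by rewrite !ffactSS !ffactn0; ring.
by rewrite !ffactSS !ffactn0 !muln1; ring.
Qed.

Lemma derivn_P_ode m l :
  ('X^2 - 2%:R *: 'X) * (P m)^`(l.+2)
  + ((2 * l.+1)%:R *: 'X + (2%:R * m%:R - 1 - 2 * l%:R)%:P) * (P m)^`(l.+1)
  + (l%:R * (l%:R + 1) - m%:R * (m%:R + 1)) *: (P m)^`(l) = 0.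
Proof.
elim: l => [|l IHl].
  by rewrite -[RHS](P_ode m) derivn0 mul0r sub0r mulr0 subr0 scaleNr.
move/(congr1 deriv): IHl; rewrite deriv0 => <-.
rewrite !derivD !derivM !derivD derivN !derivZ derivXn derivX derivC -!derivnS.
rewrite -!mul_polyC !(polyCD, polyCB, polyCN, polyCM, polyCMn, natrM) -!natr1 /=.
rewrite !(polyCD, polyCMn, polyC1).
by ring.
Qed.

Definition E (m l : nat) : rat := (P m)^`(l).[1].

(** At [x = 1] the leading factor [x^2 - 2x] is [-1], and the middle one, [2(l+1) + 2m - 1 - 2l], is
    free of [l]. *)
Lemma E_rec m l :
  (m%:R - l%:R) * (m%:R + l%:R + 1) * E m l =
  (2 * m%:R + 1) * E m l.+1 - E m l.+2.
Proof.
have /(congr1 (fun p => p.[1])) := derivn_P_ode m l.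
rewrite horner0 !(hornerD, hornerM, hornerN, hornerZ, hornerC, hornerX, hornerXn).
rewrite natrM -natr1 -!/(E m _) => h.
by apply/esym/subr0_eq; rewrite -[RHS]h; ring.
Qed.

Lemma E_sum m l :
  E m l = l`!%:R * \sum_(l <= k < m.+1) (Pcoef m k * 'C(k, l))%:R.
Proof.
rewrite /E /P poly_def linear_sum /= horner_sum.
rewrite -(big_mkord xpredT (fun k => (((Pcoef m k)%:R *: 'X^k)^`(l)).[1])).
have term k : ((Pcoef m k)%:R *: 'X^k : {poly rat})^`(l).[1] =
    l`!%:R * (Pcoef m k * 'C(k, l))%:R.
  rewrite derivnZ hornerZ derivnXn hornerMn hornerXn expr1n.
  by rewrite -bin_ffact !natrM; ring.
under eq_bigr do rewrite term.
rewrite mulr_sumr; case: (leqP l m.+1) => [le_lm|lt_ml].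
  rewrite [LHS](big_cat_nat (leq0n l) le_lm) /= big_nat big1 ?add0r // => k /andP[_ lt_kl].
  by rewrite bin_small // muln0 mulr0.
rewrite [RHS]big_geq 1?ltnW // big_nat big1 // => k /andP[_ lt_km].
by rewrite bin_small ?muln0 ?mulr0 //; lia.
Qed.

Lemma AE l m : A l m = m`!%:R / 2 ^+ (m - l) * E m l.
Proof.
rewrite /A E_sum natrM /Pcoef.
by rewrite -!mulrA; rewrite mulrCA; congr (_ * _); rewrite mulrCA.
Qed.

(** Here [b] is the [B l] of the overview for [l = m - i]. The recurrence runs downwards from
    [l = m], hence strong induction on [i]; factorials are cross-multiplied to avoid division. *)
Lemma E_odd_factor m i : (i <= m)%N ->
  exists2 b : int, odd `|b| &
  m`!%:R * i`!%:R * E m (m - i) = 2 ^+ m * (m + (m - i))`!%:R * b%:~R.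
Proof.
have base : m`!%:R * E m m = 2 ^+ m * (m + m)`!%:R.
  rewrite E_sum big_nat1 /Pcoef !subnn bin0 binn !muln1.
  have := bin_fact (leq_addr m m); rewrite addnK => <-.
  by rewrite !natrM natrX; ring.
have E0 : E m m.+1 = 0 by rewrite E_sum big_geq // mulr0.
elim/ltn_ind: i => -[|[|i]] IH le_im.
- by exists 1 => //; rewrite subn0 mulr1 base mulr1.
(* The recurrence at [l = m - 1], where [E m m.+1 = 0] removes the last term. *)
- exists (2 * m + 1)%:Z; first by rewrite absz_nat; lia.
  have := E_rec m m.-1; rewrite prednK // E0 subr0 subn1.
  have -> : m.-1%:R = m%:R - 1 :> rat by rewrite -{2}(prednK le_im) -natr1 addrK.
  have -> : (m + m.-1)%N = (m + m).-1 by lia.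
  move=> h.
  have fE : (m + m)`!%:R = (2 * m%:R) * (m + m).-1`!%:R :> rat.
    by rewrite -{1}(@prednK (m + m)) ?factS 1?prednK ?natrM ?natrD; [ring|lia..].
  have m0 : 2 * m%:R != 0 :> rat by rewrite mulf_neq0 // pnatr_eq0; lia.
  apply: (mulfI m0); rewrite mulr1.
  have -> : (2 * m + 1)%:~R = 2 * m%:R + 1 :> rat by rewrite -pmulrn natrD natrM.
  transitivity (m`!%:R * ((2 * m%:R + 1) * E m m)); first by rewrite -h; ring.
  by rewrite mulrCA base fE; ring.
have [||b1 odd_b1 h1] := IH i.+1; [lia..|].
have [||b2 odd_b2 h2] := IH i; [lia..|].
set l := (m - i.+2)%N.
have e1 : (m - i.+1 = l.+1)%N by rewrite /l; lia.
have e2 : (m - i = l.+2)%N by rewrite /l; lia.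
rewrite e1 in h1; rewrite e2 in h2.
exists ((2 * m + 1)%:Z * b1 - (i.+1 * (m + l.+2))%:Z * b2).
  (* Since [m + l + 2 = i + 2l + 4], the two factors have opposite parity. *)
  have /dvdnP[v ->] : (2 %| i.+1 * (m + l.+2))%N.
    by rewrite dvdn2 oddM (_ : m = i + l + 2)%N; [lia|rewrite /l; lia].
  rewrite (_ : _ - _ = b1 + 2 * (m%:Z * b1 - v%:Z * b2)); last by ring.
  by move: (_ - _) => w; lia.
have hr := E_rec m l.
have mlE : m%:R = l%:R + i%:R + 2 :> rat.
  by rewrite -!natrD; congr _%:R; rewrite /l; lia.
have d0 : m%:R + l%:R + 1 != 0 :> rat by rewrite -natrD natr1 pnatr_eq0.
apply: (mulfI d0).
rewrite !addnS !factS in h1 h2 *.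
rewrite !(rmorphB, rmorphM) /= -!pmulrn.
rewrite !natrM in h1 h2 *; move: hr h1 h2.
set f := (m + l)`!%:R; set g := i`!%:R; set M := m`!%:R => hr h1 h2.
transitivity (M * g * i.+1%:R * ((m%:R - l%:R) * (m%:R + l%:R + 1) * E m l)).
  by rewrite mlE; ring.
rewrite hr; transitivity ((2 * m%:R + 1) * (M * (i.+1%:R * g) * E m l.+1) -
  i.+1%:R * (M * g * E m l.+2)); first by ring.
by rewrite h1 h2; ring.
Qed.

Lemma nu2_int (n : int) : nu2 n%:~R = (logn 2 `|n|)%:Z.
Proof. by rewrite /nu2 numq_int denq_int subr0. Qed.

(** The quotient [(m+l)! / (m-l)!] is a falling factorial of length [2l]; the powers of two combine
    to [2^l], and the odd factor adds nothing. *)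
Lemma nu2_A l m : (l <= m)%N -> nu2 (A l m) = (l + logn 2 ((m + l) ^_ (2 * l)))%:Z.
Proof.
move=> le_lm.
have [b odd_b] := E_odd_factor (leq_subr l m).
rewrite subKn // => h.
have le2 : (2 * l <= m + l)%N by lia.
have := ffact_fact le2.
have -> : (m + l - 2 * l = m - l)%N by lia.
move=> hf.
have -> : A l m = ((2 ^ l * (m + l) ^_ (2 * l))%:Z * b)%:~R.
  have f0 : (m - l)`!%:R != 0 :> rat by rewrite pnatr_eq0 -lt0n fact_gt0.
  have p0 : 2 ^+ (m - l) != 0 :> rat by rewrite expf_neq0.
  apply: (mulfI f0); rewrite AE.
  transitivity ((m`!%:R * (m - l)`!%:R * E m l) / 2 ^+ (m - l)); first by ring.
  rewrite h -hf intrM -pmulrn !natrM natrX.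
  by rewrite -{1}(subnK le_lm) exprD; field.
have b0 : (0 < `|b|)%N by case: `|b|%N odd_b.
have ff0 : (0 < (m + l) ^_ (2 * l))%N by rewrite ffact_gt0.
rewrite nu2_int abszM absz_nat !lognM ?muln_gt0 ?expn_gt0 ?ff0 //.
by rewrite lognX logn_prime // muln1 (@lognE 2 `|b|) dvdn2 odd_b /= andbF addn0.
Qed.

(** Both sides are the valuation of [j (j+1) ... (j+n)], split off at either end. *)
Lemma logn_ffactS p n j : (0 < j)%N ->
  (logn p ((n + j) ^_ n) + logn p j =
   logn p ((n + j - 1) ^_ n) + logn p (n + j))%N.
Proof.
move=> j0; have ->: (n + j - 1 = (n + j).-1)%N by lia.
rewrite -!lognM ?ffact_gt0 //; [|lia..].
congr (logn p _).
have := ffactnSr (n + j) n; rewrite addKn => <-.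
by rewrite -{1}(@prednK (n + j)) ?ffactSS ?prednK 1?mulnC //; lia.
Qed.

Lemma logn_addl_small p n j :
  (0 < n)%N -> (0 < j)%N -> (logn p j < logn p n)%N -> logn p (n + j) = logn p j.
Proof.
move=> n0 j0 lt_jn.
(* [logn p] is zero for [p] not prime, so the strict inequality forces primality. *)
have p_pr : prime p by move: lt_jn; rewrite lognE (lognE p n); case: prime.
apply/eqP; rewrite eqn_leq; apply/andP; split; last first.
  rewrite -pfactor_dvdn ?addn_gt0 ?n0 // dvdn_add ?pfactor_dvdnn //.
  by rewrite pfactor_dvdn // ltnW.
rewrite leqNgt -pfactor_dvdn ?addn_gt0 ?n0 //.
by rewrite dvdn_addr ?pfactor_dvdn // ltnn.
Qed.

Theorem theorem3p5 (l : nat) (hl : (1 <= l)%N) :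
  simple_seq (2 ^ (1 + logn 2 l))%N (fun j : nat => nu2 (A l (l + j - 1)%N)).
Proof.
set s := (2 ^ (1 + logn 2 l))%N.
have s0 : (0 < s)%N by rewrite expn_gt0.
have log2l : logn 2 (2 * l) = (1 + logn 2 l)%N by rewrite lognM // logn_prime.
have log_s : logn 2 s = (1 + logn 2 l)%N by rewrite pfactorK.
have aE j : (0 < j)%N ->
    nu2 (A l (l + j - 1)%N) = (l + logn 2 ((2 * l + j - 1) ^_ (2 * l)))%:Z.
  by move=> j0; rewrite nu2_A; [do 4 f_equal; lia|lia].
have step j : (0 < j)%N -> ~~ (s %| j)%N ->
    nu2 (A l (l + j.+1 - 1)%N) = nu2 (A l (l + j - 1)%N).
  (* Non-divisibility bounds the valuation of [j] strictly below that of [2l], so [2l + j] and [j]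
     have equal valuations. *)
  move=> j0; rewrite pfactor_dvdn // -ltnNge => ndv.
  have := logn_ffactS 2 (2 * l) j0.
  rewrite logn_addl_small ?muln_gt0 ?log2l // => /addIn h.
  by rewrite !aE // addnS subn1 /= h.
have jump : nu2 (A l (l + s.+1 - 1)%N) <> nu2 (A l (l + s - 1)%N).
  rewrite !aE // addnS subn1 /= => -[/addnI h].
  have := logn_ffactS 2 (2 * l) s0; rewrite h => /addnI.
  apply/eqP; rewrite neq_ltn; apply/orP; left.
  rewrite log_s -pfactor_dvdn ?addn_gt0 ?s0 ?orbT //.
  (* With [q] the odd part of [l], [2l + s = (q+1) s] and [q + 1] is even, so [2l + s] has a larger
     valuation than [s]. *)
  have [|q] := @pfactor_coprime 2 l _ hl; rewrite // coprime2n => odd_q lE.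
  have -> : (2 * l + s = q.+1 * 2 ^ (1 + logn 2 l))%N.
    by rewrite /s {1}lE add1n expnS; ring.
  by rewrite expnS dvdn_mul // dvdn2 /= odd_q.
split; first by rewrite /s expnS leq_pmulr // expn_gt0.
- move=> t j /andP[lo hi].
  have [i -> lt_is] : exists2 i, j = (s * t + 1 + i)%N & (i < s)%N.
    by exists (j - (s * t + 1))%N; lia.
  elim: i lt_is {lo hi} => [|i IH] lt_is; first by rewrite addn0.
  rewrite addnS step ?IH ?(ltnW lt_is) //; first by lia.
  by rewrite -addnA dvdn_addr ?dvdn_mulr // add1n gtnNdvd.
(* A longer first block would contain both [s] and [s + 1], against [jump]. *)
move=> s' hs'; rewrite leqNgt; apply/negP => lt_ss'.
apply: jump; rewrite (hs' 0%N s.+1) ?(hs' 0%N s) //; lia.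
Qed.
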